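(* Let $\alpha,\beta>0$ be constants, let $n>1$ be an integer, $T>0$, $\tau=T/n$, and let $u_0,u_1,\dots,u_n\in D(\mathcal L_0)$ satisfy the homogeneous locally linear three-layer scheme $$\frac{u_{k+1}-2u_k+u_{k-1}}{\tau^2}-\frac12\,q_k\left(\Delta u_{k+1}+\Delta u_{k-1}\right)=0,\qquad q_k=\alpha+\beta\iint_\Omega|\nabla u_k|^2\,dx\,dy,\qquad k=1,2,\dots,n-1 .$$ For $k=1,\dots,n$ define $$\widetilde E_{1,k}=\mathcal K_k+\frac{\alpha}{2}\left(V_{k-1}+V_k\right)+\beta V_{k-1}V_k .$$ Then $\widetilde E_{1,k+1}=\widetilde E_{1,1}$ for every $k=1,2,\dots,n-1$.
   Context: $\Omega\subset\mathbb R^2$ is a bounded convex domain (in particular with Lipschitz boundary). $D(\mathcal L_0)=\{u\in C^2(\overline\Omega): u|_{\partial\Omega}=0\}$ (real-valued functions). For a sequence $(u_k)$, $$\mathcal K_k=\frac12\iint_\Omega\left(\frac{u_k-u_{k-1}}{\tau}\right)^2dx\,dy,\qquad V_k=\frac12\iint_\Omega|\nabla u_k|^2\,dx\,dy .$$ *)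

(* Defs.v *)
From HB Require Import structures.
From mathcomp Require Import all_boot all_order all_algebra.
From mathcomp Require Import all_classical all_reals all_analysis.
Set Implicit Arguments.
Unset Strict Implicit.
Unset Printing Implicit Defensive.
Import Order.TTheory GRing.Theory Num.Theory.
Import numFieldNormedType.Exports.
Local Open Scope classical_set_scope.
Local Open Scope ring_scope.

(* The plane R^2 is R * R; its library norm is the sup norm, which induces the
   usual topology and the usual bounded sets. *)

Definition domain (R : realType) (Om : set (R * R)) : Prop :=
  [/\ open Om, connected Om & Om !=set0].

Definition bounded_convex_domain (R : realType) (Om : set (R * R)) : Prop :=
  [/\ domain Om, bounded_set Om & @convex_set R (R * R)%type Om].

Definition boundary (R : realType) (Om : set (R * R)) : set (R * R) :=
  closure Om `\` interior Om.

Definition e_x (R : realType) : R * R := (1, 0).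
Definition e_y (R : realType) : R * R := (0, 1).

(* Functions on the closure of Om are represented by total functions on R * R.
   For an open Om, the partial derivatives at points of Om only depend on the
   values in Om. *)

Definition dx (R : realType) (u : R * R -> R) : R * R -> R :=
  fun p => 'D_(e_x R) u p.
Definition dy (R : realType) (u : R * R -> R) : R * R -> R :=
  fun p => 'D_(e_y R) u p.

Definition grad_sq (R : realType) (u : R * R -> R) (p : R * R) : R :=
  dx u p ^+ 2 + dy u p ^+ 2.

Definition laplacian (R : realType) (u : R * R -> R) (p : R * R) : R :=
  dx (dx u) p + dy (dy u) p.

Definition has_partials (R : realType) (Om : set (R * R)) (u : R * R -> R)
    : Prop :=
  forall p, Om p -> derivable u p (e_x R) /\ derivable u p (e_y R).

Definition extends_to_closure (R : realType) (Om : set (R * R))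
    (f : R * R -> R) : Prop :=
  exists g : R * R -> R,
    {within closure Om, continuous g} /\ (forall p, Om p -> f p = g p).

(* C^2 of the closure of Om: u is continuous on the closure, and its partial
   derivatives of order 1 and 2 exist in Om and extend continuously to the
   closure (in particular they are continuous in Om). *)
Definition C2_closure (R : realType) (Om : set (R * R)) (u : R * R -> R)
    : Prop :=
  [/\ {within closure Om, continuous u},
      has_partials Om u
        /\ (extends_to_closure Om (dx u) /\ extends_to_closure Om (dy u)),
      has_partials Om (dx u)
        /\ (extends_to_closure Om (dx (dx u))
            /\ extends_to_closure Om (dy (dx u)))
    & has_partials Om (dy u)
        /\ (extends_to_closure Om (dx (dy u))
            /\ extends_to_closure Om (dy (dy u)))].

Definition dom_L0 (R : realType) (Om : set (R * R)) (u : R * R -> R) : Prop :=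
  C2_closure Om u /\ (forall p, boundary Om p -> u p = 0).

Definition area (R : realType) :=
  ((@lebesgue_measure R) \x (@lebesgue_measure R))%E.

Definition iint (R : realType) (Om : set (R * R)) (f : R * R -> R) : R :=
  (\int[@area R]_(p in Om) f p)%R.

(* Used for k >= 1 only. *)
Definition kinetic (R : realType) (Om : set (R * R)) (tau : R)
    (u : nat -> R * R -> R) (k : nat) : R :=
  2^-1 * iint Om (fun p => ((u k p - u k.-1 p) / tau) ^+ 2).

Definition potential (R : realType) (Om : set (R * R))
    (u : nat -> R * R -> R) (k : nat) : R :=
  2^-1 * iint Om (grad_sq (u k)).

Definition qcoef (R : realType) (Om : set (R * R)) (alpha beta : R)
    (u : nat -> R * R -> R) (k : nat) : R :=
  alpha + beta * iint Om (grad_sq (u k)).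

(* Used for k >= 1 only. *)
Definition energy1 (R : realType) (Om : set (R * R)) (alpha beta tau : R)
    (u : nat -> R * R -> R) (k : nat) : R :=
  kinetic Om tau u k
    + alpha / 2 * (potential Om u k.-1 + potential Om u k)
    + beta * potential Om u k.-1 * potential Om u k.

(* Main.v *)
Require Import Defs.
From HB Require Import structures.
From mathcomp Require Import all_boot all_order all_algebra.
From mathcomp Require Import all_classical all_reals all_analysis.
From mathcomp Require Import measurable_realfun ring.
Import Order.TTheory GRing.Theory Num.Theory.
Import numFieldNormedType.Exports.
Local Open Scope classical_set_scope.
Local Open Scope ring_scope.

(** Multiply the scheme by [u k.+1 - u k.-1] and integrate over [Om]. Since
    [(a - 2 c + b) (a - b) = (a - c)^2 - (c - b)^2], the time difference gives
    twice the increment of the kinetic energy. By Green's identity, and with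
    [V k] the potential, the Laplacian part gives [q k * (V k.+1 - V k.-1)]
    with [q k = alpha + 2 beta V k]. The sum of the two is twice the increment
    of the energy from [k] to [k.+1] ([energy_step]), which is thus zero.

    The analytic content is Green's identity for functions that vanish on the
    boundary ([green_identity]). On a convex domain it needs no divergence
    theorem: for each coordinate direction, Fubini's theorem
    ([iint_slices_eq0]) reduces it to slices, which are bounded open intervals
    with endpoints on the boundary of [Om], and there it is the fundamental
    theorem of calculus for a product that vanishes at both ends
    ([integral_slice]). All integrands extend continuously to the compact
    closure of [Om], which makes them integrable ([extends_integrable]). *)

(** * Integrability in the plane *)

(** The sigma-algebra here is the one generated by measurable rectangles, so
    the countability of a base of the plane has to enter: an open set is the
    union of the squares with rational centre and radius that it contains. *)
Lemma open_measurable_plane {R : realType} {U : set (R * R)} :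
  open U -> measurable (U : set (measurableTypeR R * measurableTypeR R)).
Proof.
move=> oU.
pose sq (i : rat * rat * rat) : set (R * R) :=
  ball (ratr i.1.1 : R) (ratr i.2) `*` ball (ratr i.1.2 : R) (ratr i.2).
have -> : U = \bigcup_(i in [set i | sq i `<=` U]) sq i; last first.
  rewrite bigcup_mkcond; apply: countable_bigcupT_measurable => // i.
  by case: ifPn => // _; apply: measurableX; apply: open_measurable; exact: ball_open.
apply/seteqP; split => [[x y] Uxy|z [i sqU]]; last exact: sqU.
have /nbhs_ballP[e /= e0 eU] : nbhs (x, y) U by exact: open_nbhs_nbhs.
(* A square of radius below [e / 2] around a rational point near [(x, y)] stays,
   by the triangle inequality, in the ball of radius [e] around [(x, y)]. *)
have [r] := rat_in_itvoo (divr_gt0 e0 (ltr0n R 2)).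
rewrite in_itv/= => /andP[r0 re].
have approx (t : R) : exists q : rat, ball (ratr q : R) (ratr r : R) t.
  have tr : t - ratr r < t + ratr r by rewrite ltrD2l gtrN.
  have [q] := rat_in_itvoo tr.
  by rewrite in_itv/= -ltr_distl => tq; exists q; rewrite -ball_normE.
have [[p px] [q qy]] := (approx x, approx y).
exists (p, q, r); last (by split); move=> [x' y'] [/= px' qy']; apply: eU.
have near c s s' : ball (ratr c : R) (ratr r : R) s ->
    ball (ratr c : R) (ratr r : R) s' -> ball s e s'.
  move=> cs cs'; apply: le_ball (ball_triangle (ball_sym cs) cs').
  by rewrite -mulr2n -mulr_natr -ler_pdivlMr// ltW.
by split; [exact: near px px'|exact: near qy qy'].
Qed.

Lemma bounded_plane_square {R : realType} {Om : set (R * R)} :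
  bounded_set Om -> exists M : R, Om `<=` `[- M, M] `*` `[- M, M].
Proof.
move=> /ex_strict_bound_gt0[M _ bM]; exists M => -[x y] /bM /ltW /=.
by rewrite prod_normE/= ge_max => /andP[xM yM]; split; rewrite /= in_itv/= -ler_norml.
Qed.

Lemma compact_closure_plane {R : realType} {Om : set (R * R)} :
  bounded_set Om -> compact (closure Om).
Proof.
move=> /bounded_plane_square[M OmM].
have cK : compact (`[- M, M] `*` `[- M, M] : set (R * R)).
  by apply: compact_setX; exact: segment_compact.
apply: (subclosed_compact _ cK); first exact: closed_closure.
rewrite [X in _ `<=` X](closure_id _).1; first exact: closure_subset.
by apply: compact_closed => //; exact: norm_hausdorff.
Qed.

Lemma area_bounded {R : realType} {Om : set (R * R)} :
  open Om -> bounded_set Om -> (@area R Om < +oo)%E.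
Proof.
move=> oOm /bounded_plane_square[M OmM].
apply: (@le_lt_trans _ _ (area (`[- M, M]%classic `*` `[- M, M]%classic))).
  apply: le_measure => //; rewrite inE.
  - exact: open_measurable_plane.
  - by apply: measurableX; exact: measurable_itv.
rewrite /area product_measure1E//= !lebesgue_measure_itv/=.
by case: ifPn => _; rewrite ?mule0 -?EFinD -?EFinM ltry.
Qed.

(** The extension is bounded because the closure is compact, and it is
    continuous on the open set, hence measurable there. *)
Lemma extends_integrable {R : realType} {Om : set (R * R)} (f : R * R -> R) :
  open Om -> bounded_set Om -> extends_to_closure Om f ->
  (@area R).-integrable Om (EFin \o f).
Proof.
move=> oOm bOm [g [cg fg]].
have mOm := open_measurable_plane oOm.
suff : (@area R).-integrable Om (EFin \o g).
  apply: eq_integrable => //= p; rewrite inE => Omp.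
  by rewrite fg.
apply: measurable_bounded_integrable => //.
- exact: area_bounded.
- apply: (measurability _ (RGenOpens.measurableE R)).
  move=> _ [_ [a [b ->] <-]]; apply: open_measurable_plane.
  have : {within Om, continuous g}.
    by apply: continuous_subspaceW cg; exact: subset_closure.
  rewrite continuous_open_subspace// => cOm.
  rewrite openE => p [Omp gp]; apply: filterI; first exact: open_nbhs_nbhs.
  by apply: cOm; [rewrite inE|apply: open_nbhs_nbhs; split=> //; exact: interval_open].
- have [M [rM bM]] :=
    compact_bounded (continuous_compact cg (compact_closure_plane bOm)).
  exists M; split=> // N MN p Omp; apply: (bM N MN).
  by exists p => //; exact: subset_closure.
Qed.

(** * The fundamental theorem of calculus on a slice *)

Lemma open_interval_ends {R : realType} {S : set R} :
  open S -> is_interval S -> bounded_set S -> S !=set0 ->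
  exists a b : R, [/\ a < b, S = `]a, b[%classic & `[a, b] `<=` closure S].
Proof.
move=> oS iS /ex_strict_bound_gt0[M _ bM] [s Ss].
have lS : has_lbound S by exists (- M) => x /bM /ltW /=; rewrite ler_norml => /andP[].
have uS : has_ubound S by exists M => x /bM /ltW /=; rewrite ler_norml => /andP[].
have SE : S = `]inf S, sup S[%classic.
  by rewrite set_itvoo -interval_bounded_interior// ((interior_id S).1 oS).
have ab : inf S < sup S.
  by move: (Ss); rewrite [X in X s]SE /= in_itv/= => /andP[]; exact: lt_trans.
exists (inf S), (sup S); split => // x /=; rewrite in_itv/= => /andP[].
rewrite le_eqVlt => /predU1P[<- _|ax].
  move=> B /nbhs_ballP[e /= e0 eB].
  have [y Sy ye] := inf_adherent e0 (conj (ex_intro _ s Ss) lS).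
  exists y; split => //; apply: eB; rewrite -ball_normE/= distrC ger0_norm.
    by rewrite ltrBlDl.
  by rewrite subr_ge0 ge_inf.
rewrite le_eqVlt => /predU1P[->|xb]; first by apply: closure_sup => //; exists s.
by apply: subset_closure; rewrite SE /= in_itv/= ax.
Qed.

(** The fundamental theorem of calculus on an open interval given only as a set,
    so that it applies to slices whose endpoints have no formula. *)
Lemma integral_derivative_vanishing {R : realType} {S : set R} {G g : R -> R} :
  open S -> is_interval S -> bounded_set S ->
  {within closure S, continuous G} -> {within closure S, continuous g} ->
  (forall t, S t -> is_derive t 1 G (g t)) ->
  (forall t, closure S t -> ~ S t -> G t = 0) ->
  (\int[lebesgue_measure]_(t in S) (g t)%:E = 0)%E.
Proof.
move=> oS iS bS cG cg dG G0.
have [->|/set0P S0] := eqVneq S set0; first by rewrite integral_set0.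
have [a [b [ab SE clS]]] := open_interval_ends oS iS bS S0.
have cG' : {within `[a, b], continuous G} by exact: continuous_subspaceW cG.
have cg' : {within `[a, b], continuous g} by exact: continuous_subspaceW cg.
have end0 t : t \in `[a, b] -> t \notin `]a, b[ -> G t = 0.
  move=> tab /negP tS; apply: G0; first exact: clS.
  by rewrite SE.
have /(continuous_within_itvP _ ab)[coo ca cb] := cG'.
(* The endpoints are negligible; the closed interval is where the fundamental
   theorem of calculus is available. *)
rewrite SE -(@integral_itv_bndoo _ _ _ _ true false); last first.
  apply/measurable_EFinP; apply: open_continuous_measurable_fun.
    exact: interval_open.
  by have /(continuous_within_itvP _ ab)[coo' _ _] := cg' => x; rewrite inE; exact: coo'.
rewrite (continuous_FTC2 ab cg' (F := G)).
- rewrite !end0 ?subee// ?in_itv/= ?lexx ?ltxx ?(ltW ab)// ?andbF//.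
- split => // t tab; have St : S t by rewrite SE.
  by have [] := dG t St.
- move=> t tab; have St : S t by rewrite SE.
  by rewrite derive1E; have [] := dG t St.
Qed.

(** Both coordinate directions are treated at once: a slice of a plane set is
    its preimage under a line. *)
Definition line {R : realType} (c e : R * R) (t : R) : R * R := c + t *: e.

Lemma continuous_line {R : realType} (c e : R * R) : continuous (line c e).
Proof.
by move=> t; apply: cvgD; [exact: cvg_cst|apply: cvgZr_tmp; exact: cvg_id].
Qed.

Lemma open_slice {R : realType} {Om : set (R * R)} (c e : R * R) :
  open Om -> open (line c e @^-1` Om).
Proof. by apply: open_comp => t _; exact: continuous_line. Qed.

Lemma is_interval_slice {R : realType} {Om : set (R * R)} (c e : R * R) :
  @convex_set R (R * R)%type Om -> is_interval (line c e @^-1` Om).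
Proof.
move=> cvx; apply/is_intervalPlt => x y Sx Sy z /andP[xz zy].
have xy : 0 < y - x by rewrite subr_gt0 (lt_trans xz).
have k0 : 0 <= (y - z) / (y - x) by rewrite divr_ge0 ?subr_ge0 ?ltW// -subr_gt0.
have k1 : (y - z) / (y - x) <= 1 by rewrite ler_pdivrMr// mul1r lerB// ltW.
have := cvx (line c e x) (line c e y) (Itv01 k0 k1).
rewrite !inE => /(_ Sx Sy).
rewrite (_ : conv _ _ _ = (line c e z : convex_lmodType (R * R)%type))//.
rewrite /conv/= /line !scalerDr addrACA -scalerDl !scalerA -scalerDl.
rewrite unstable.add_onemK scale1r /unstable.onem; congr (_ + _ *: _); field.
by rewrite gt_eqF.
Qed.

Lemma bounded_slice {R : realType} {Om : set (R * R)} (c e : R * R) :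
  `|e| = 1 -> bounded_set Om -> bounded_set (line c e @^-1` Om).
Proof.
move=> e1 /ex_strict_bound_gt0[M _ bM]; exists (M + `|c|); split => //= N MN t /bM /= lM.
apply/ltW/(le_lt_trans _ MN); rewrite -[`|t|]mulr1 -e1 -normrZ.
rewrite -[t *: e](addrK c) (addrC (t *: e)); apply: le_trans (ler_normB _ _) _.
by rewrite lerD2r ltW.
Qed.

Lemma closure_slice {R : realType} {Om : set (R * R)} (c e : R * R) :
  closure (line c e @^-1` Om) `<=` line c e @^-1` closure Om.
Proof.
move=> t clt B Bt; have /(_ (line c e @^-1` B)) := clt.
by case=> [|s [Oms Bs]]; [exact: (@continuous_line _ c e t)|exists (line c e s)].
Qed.

Lemma continuous_slice {R : realType} {Om : set (R * R)} {g : R * R -> R} (c e : R * R) :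
  {within closure Om, continuous g} ->
  {within closure (line c e @^-1` Om), continuous (g \o line c e)}.
Proof.
move=> /subspace_continuousP cg; apply/subspace_continuousP => t clt.
apply: (@cvg_comp _ _ _ _ g _ (within (closure Om) (nbhs (line c e t)))).
  2: exact/cg/closure_slice.
move=> B wB; have lB : nbhs t (fun s => closure Om (line c e s) -> B (line c e s)).
  exact: (@continuous_line _ c e t _ wB).
suff : nbhs t (fun s => closure (line c e @^-1` Om) s -> B (line c e s)) by [].
by apply: filterS lB => s Bs cls; apply: Bs; exact: closure_slice.
Qed.

Lemma is_derive_line {R : realType} {f : R * R -> R} (c e : R * R) (t : R) :
  derivable f (line c e t) e ->
  is_derive t 1 (f \o line c e) ('D_e f (line c e t)).
Proof.
have E : (fun h : R => h^-1 *: (((f \o line c e) \o shift t) (h *: (1 : R)) -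
    (f \o line c e) t)) =
  (fun h : R => h^-1 *: ((f \o shift (line c e t)) (h *: e) - f (line c e t))).
  apply/funext => h /=; congr (_ *: (f _ - _)).
  by rewrite /line -[h *: 1]/(h * 1) mulr1 scalerDl addrCA.
by move=> df; split; rewrite /derivable /derive E.
Qed.

(** The integrand is the derivative of [w * v] along the line. The slice is a
    bounded open interval because the set is open, bounded and convex, and its
    endpoints lie on the boundary of the set, where [v] vanishes. *)
Lemma integral_slice {R : realType} {Om : set (R * R)} (c e : R * R)
    (w v : R * R -> R) :
  open Om -> bounded_set Om -> @convex_set R (R * R)%type Om -> `|e| = 1 ->
  (forall p, Om p -> derivable w p e /\ derivable v p e) ->
  extends_to_closure Om w -> extends_to_closure Om ('D_e w) ->
  extends_to_closure Om ('D_e v) ->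
  {within closure Om, continuous v} -> (forall p, boundary Om p -> v p = 0) ->
  (\int[lebesgue_measure]_(t in line c e @^-1` Om)
    ('D_e w (line c e t) * v (line c e t) +
     w (line c e t) * 'D_e v (line c e t))%:E = 0)%E.
Proof.
move=> oOm bOm cvx e1 dwv [W [cW wW]] [W' [cW' wW']] [V' [cV' vV']] cv v0.
set l := line c e; set S := l @^-1` Om.
(* The extensions are used rather than [w] and its derivative, because the 1D
   result asks for continuity up to the endpoints. *)
pose G := (W \o l) * (v \o l).
pose g := (W' \o l) * (v \o l) + (W \o l) * (V' \o l).
have oS : open S by exact: open_slice.
rewrite (@eq_integral _ _ _ lebesgue_measure _ (EFin \o g)); last first.
  by move=> t; rewrite inE => St /=; rewrite wW// wW'// vV'.
apply: (@integral_derivative_vanishing R S G) => //.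
- exact: is_interval_slice.
- exact: bounded_slice.
- by move=> t; apply: cvgM; exact: continuous_slice.
- by move=> t; apply: cvgD; apply: cvgM; exact: continuous_slice.
- move=> t St.
  apply: (@near_eq_is_derive _ _ _ ((w \o l) * (v \o l))).
    have : nbhs t S by exact: open_nbhs_nbhs.
    by apply: filterS => s Ss; rewrite /G/= !fctE/= wW.
  have [dw dv] := dwv _ St.
  have -> : g t = (w \o l) t *: 'D_e v (l t) + (v \o l) t *: 'D_e w (l t).
    by rewrite /g !fctE/= -wW// -wW'// -vV'// addrC; congr (_ + _); rewrite mulrC.
  exact: is_deriveM (is_derive_line _ _ _ dw) (is_derive_line _ _ _ dv).
- move=> t clt St; rewrite /G !fctE/= v0 ?mulr0//; split.
    exact: closure_slice.
  by rewrite (interior_id _).1.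
Qed.

(** * Linearity of the integral on functions extending to the closure *)

Lemma extendsD {R : realType} {Om : set (R * R)} (f g : R * R -> R) :
  extends_to_closure Om f -> extends_to_closure Om g ->
  extends_to_closure Om (fun p => f p + g p).
Proof.
move=> [F [cF fF]] [G [cG gG]]; exists (fun p => F p + G p).
by split=> [p|p Omp]; [apply: cvgD; [exact: cF|exact: cG]|rewrite fF// gG].
Qed.

Lemma extendsM {R : realType} {Om : set (R * R)} (f g : R * R -> R) :
  extends_to_closure Om f -> extends_to_closure Om g ->
  extends_to_closure Om (fun p => f p * g p).
Proof.
move=> [F [cF fF]] [G [cG gG]]; exists (fun p => F p * G p).
by split=> [p|p Omp]; [apply: cvgM; [exact: cF|exact: cG]|rewrite fF// gG].
Qed.

Lemma extendsZ {R : realType} {Om : set (R * R)} (r : R) (f : R * R -> R) :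
  extends_to_closure Om f ->
  extends_to_closure Om (fun p => r * f p).
Proof.
apply: extendsM; exists (fun=> r); split=> // p; exact: cvg_cst.
Qed.

Lemma extendsB {R : realType} {Om : set (R * R)} (f g : R * R -> R) :
  extends_to_closure Om f -> extends_to_closure Om g ->
  extends_to_closure Om (fun p => f p - g p).
Proof.
move=> ef eg; have := extendsD _ _ ef (extendsZ (-1) _ eg).
by under eq_fun do rewrite mulN1r.
Qed.

Lemma iint_eq {R : realType} {Om : set (R * R)} (f g : R * R -> R) :
  (forall p, Om p -> f p = g p) -> iint Om f = iint Om g.
Proof. by move=> fg; apply: eq_Rintegral => p; rewrite inE; exact: fg. Qed.

Lemma iintD {R : realType} {Om : set (R * R)} (oOm : open Om)
    (bOm : bounded_set Om) (f g : R * R -> R) :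
  extends_to_closure Om f -> extends_to_closure Om g ->
  iint Om (fun p => f p + g p) = iint Om f + iint Om g.
Proof.
by move=> ef eg; apply: RintegralD;
  [exact: open_measurable_plane|exact: extends_integrable|exact: extends_integrable].
Qed.

Lemma iintB {R : realType} {Om : set (R * R)} (oOm : open Om)
    (bOm : bounded_set Om) (f g : R * R -> R) :
  extends_to_closure Om f -> extends_to_closure Om g ->
  iint Om (fun p => f p - g p) = iint Om f - iint Om g.
Proof.
by move=> ef eg; apply: RintegralB;
  [exact: open_measurable_plane|exact: extends_integrable|exact: extends_integrable].
Qed.

Lemma iintZ {R : realType} {Om : set (R * R)} (oOm : open Om)
    (bOm : bounded_set Om) (r : R) (f : R * R -> R) :
  extends_to_closure Om f ->
  iint Om (fun p => r * f p) = r * iint Om f.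
Proof.
by move=> ef; apply: RintegralZl; [exact: open_measurable_plane|exact: extends_integrable].
Qed.

(** * Green's identity *)

Lemma line_x {R : realType} (x y : R) : line (0, y) (e_x R) x = (x, y).
Proof.
rewrite /line /e_x; congr pair => /=.
  by rewrite add0r -[_ *: _]/(x * 1) mulr1.
by rewrite -[_ *: _]/(x * 0) mulr0 addr0.
Qed.

Lemma line_y {R : realType} (x y : R) : line (x, 0) (e_y R) y = (x, y).
Proof.
rewrite /line /e_y; congr pair => /=.
  by rewrite -[_ *: _]/(y * 0) mulr0 addr0.
by rewrite add0r -[_ *: _]/(y * 1) mulr1.
Qed.

Lemma norm_e_x {R : realType} : `|e_x R| = 1.
Proof. by rewrite prod_normE/= normr1 normr0 max_l. Qed.

Lemma norm_e_y {R : realType} : `|e_y R| = 1.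
Proof. by rewrite prod_normE/= normr1 normr0 max_r. Qed.

(** Fubini for the function extended by zero outside [Om]: one integrates first
    along the slices parallel to [e]. *)
Lemma iint_slices_eq0 {R : realType} {Om : set (R * R)} (e : R * R)
    (F : R * R -> R) :
  open Om -> bounded_set Om -> extends_to_closure Om F ->
  e = e_x R \/ e = e_y R ->
  (forall c, (\int[lebesgue_measure]_(t in line c e @^-1` Om)
     (F (line c e t))%:E = 0)%E) ->
  iint Om F = 0.
Proof.
move=> oOm bOm eF exy F0.
have := extends_integrable _ oOm bOm eF.
rewrite integrable_mkcond; last exact: open_measurable_plane.
move=> iF; rewrite /iint /Rintegral integral_mkcond.
have sliceE c : (\int[lebesgue_measure]_t ((EFin \o F) \_ Om) (line c e t) = 0)%E.
  by rewrite -[RHS](F0 c) [RHS]integral_mkcond.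
case: exy => ee; rewrite ee in sliceE.
- rewrite /area -integral21_prod_meas1//= integral0_eq//= => y _.
  rewrite -[RHS](sliceE (0, y)) /fubini_G.
  by apply: eq_integral => x _; rewrite line_x.
- rewrite /area -integral12_prod_meas1//= integral0_eq//= => x _.
  rewrite -[RHS](sliceE (x, 0)) /fubini_F.
  by apply: eq_integral => y _; rewrite line_y.
Qed.

(** The sum of the two integrands is a derivative along every line parallel to
    [e], and the boundary terms are zero because [v] is zero on the boundary. *)
Lemma iint_by_parts {R : realType} {Om : set (R * R)} (e : R * R)
    (w v : R * R -> R) :
  bounded_convex_domain Om -> e = e_x R \/ e = e_y R ->
  (forall p, Om p -> derivable w p e /\ derivable v p e) ->
  extends_to_closure Om w -> extends_to_closure Om ('D_e w) ->
  extends_to_closure Om ('D_e v) ->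
  {within closure Om, continuous v} -> (forall p, boundary Om p -> v p = 0) ->
  iint Om (fun p => 'D_e w p * v p) = - iint Om (fun p => w p * 'D_e v p).
Proof.
move=> [[oOm _ _] bOm cvx] exy dwv ew ew' ev' cv v0.
have ev : extends_to_closure Om v by exists v.
apply/eqP; rewrite -addr_eq0 -iintD//; [|exact: extendsM..].
apply/eqP/(iint_slices_eq0 e) => //; first by apply: extendsD; exact: extendsM.
move=> c; apply: integral_slice => //.
by case: exy => ->; [exact: norm_e_x|exact: norm_e_y].
Qed.

(** Each second derivative in the Laplacian is integrated by parts in its own
    direction, with the first derivative of [w] as the other factor. *)
Lemma green_identity {R : realType} {Om : set (R * R)} {w v : R * R -> R} :
  bounded_convex_domain Om -> dom_L0 Om w -> dom_L0 Om v ->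
  iint Om (fun p => laplacian w p * v p) =
  - iint Om (fun p => dx w p * dx v p + dy w p * dy v p).
Proof.
move=> hOm [[cw [pw [ewx ewy]] [pwx [ewxx _]] [pwy [_ ewyy]]] _].
move=> [[cv [pv [evx evy]] _ _] v0].
have [[oOm _ _] bOm _] := hOm.
have ev : extends_to_closure Om v by exists v.
have partsx : iint Om (fun p => dx (dx w) p * v p) =
    - iint Om (fun p => dx w p * dx v p).
  apply: (iint_by_parts (e_x R) (dx w) v hOm (or_introl erefl) _
    ewx ewxx evx cv v0) => p Omp.
  by have [? _] := pwx p Omp; have [? _] := pv p Omp.
have partsy : iint Om (fun p => dy (dy w) p * v p) =
    - iint Om (fun p => dy w p * dy v p).
  apply: (iint_by_parts (e_y R) (dy w) v hOm (or_intror erefl) _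
    ewy ewyy evy cv v0) => p Omp.
  by have [_ ?] := pwy p Omp; have [_ ?] := pv p Omp.
transitivity (iint Om (fun p => dx (dx w) p * v p + dy (dy w) p * v p)).
  by apply: iint_eq => p _; rewrite mulrDl.
rewrite (iintD oOm bOm (fun p => dx (dx w) p * v p)); [|exact: extendsM..].
rewrite (iintD oOm bOm (fun p => dx w p * dx v p)); [|exact: extendsM..].
by rewrite opprD; exact: (congr2 +%R partsx partsy).
Qed.

Lemma extends_laplacian {R : realType} {Om : set (R * R)} {u : R * R -> R} :
  dom_L0 Om u -> extends_to_closure Om (laplacian u).
Proof.
by move=> [[_ _ [_ [exx _]] [_ [_ eyy]]] _]; exact: extendsD.
Qed.

(** * Conservation of the energy *)

(** Testing the scheme with [u k.+1 - u k.-1] turns the second difference into a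
    difference of two squares and, by Green's identity, the averaged Laplacian
    into a difference of Dirichlet integrals, the mixed terms cancelling by
    symmetry. The weight [qcoef] is affine in the Dirichlet integral of [u k],
    which multiplies those of the two neighbouring layers: this produces the
    product of consecutive potentials in the energy. *)
Lemma energy_step {R : realType} {Om : set (R * R)} (alpha beta tau : R)
    (u : nat -> R * R -> R) (k : nat) :
  bounded_convex_domain Om ->
  dom_L0 Om (u k.-1) -> dom_L0 Om (u k) -> dom_L0 Om (u k.+1) ->
  (forall p, Om p ->
     (u k.+1 p - 2 * u k p + u k.-1 p) / tau ^+ 2
       - 2^-1 * qcoef Om alpha beta u k
           * (laplacian (u k.+1) p + laplacian (u k.-1) p) = 0) ->
  energy1 Om alpha beta tau u k.+1 = energy1 Om alpha beta tau u k.
Proof.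
move=> hOm; rewrite /energy1 /kinetic /potential /qcoef /=.
set a := u k.+1; set b := u k.-1; set c := u k => db dc da scheme.
have [[oOm _ _] bOm _] := hOm.
have ext f : dom_L0 Om f -> extends_to_closure Om f by case=> -[cf _ _ _] _; exists f.
have [[ea eb] ec] := (ext _ da, ext _ db, ext _ dc).
have [ela elb] := (extends_laplacian da, extends_laplacian db).
pose G w v := iint Om (fun p => dx w p * dx v p + dy w p * dy v p).
have Gab : G a b = G b a by apply: iint_eq => p _; ring.
have Gsq w : G w w = iint Om (grad_sq w) by apply: iint_eq => p _; rewrite /grad_sq; ring.
have esq f g : extends_to_closure Om f -> extends_to_closure Om g ->
    extends_to_closure Om (fun p => ((f p - g p) / tau) ^+ 2).
  move=> ef eg; under eq_fun do rewrite mulrC expr2.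
  by apply: extendsM; apply/extendsZ/extendsB.
set q := alpha + _ in scheme.
have [[eaa eba] [eab ebb]] := ((extendsM _ _ ela ea, extendsM _ _ elb ea),
  (extendsM _ _ ela eb, extendsM _ _ elb eb)).
pose X p := laplacian a p * a p + laplacian b p * a p -
  (laplacian a p * b p + laplacian b p * b p).
have IX : iint Om X = G b b - G a a.
  rewrite /X (iintB oOm bOm _ _ (extendsD _ _ eaa eba) (extendsD _ _ eab ebb)).
  rewrite (iintD oOm bOm _ _ eaa eba) (iintD oOm bOm _ _ eab ebb).
  have IaG : _ = - G a a + - G b a :=
    congr2 +%R (green_identity hOm da da) (green_identity hOm db da).
  have IbG : _ = - G a b + - G b b :=
    congr2 +%R (green_identity hOm da db) (green_identity hOm db db).
  transitivity (- G a a + - G b a - (- G a b + - G b b)).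
    exact: (congr2 (fun x y => x - y) IaG IbG).
  by rewrite Gab; move: (G a a) (G b a) (G b b) => *; ring.
have eX : extends_to_closure Om X by apply: extendsB; exact: extendsD.
have : iint Om (fun p => ((a p - c p) / tau) ^+ 2) -
       iint Om (fun p => ((c p - b p) / tau) ^+ 2) =
       2^-1 * q * (G b b - G a a).
  rewrite -(iintB oOm bOm _ _ (esq _ _ ea ec) (esq _ _ ec eb)).
  rewrite -IX -(iintZ oOm bOm _ _ eX); apply: iint_eq => p.
  move=> /scheme /eqP; rewrite subr_eq0 => /eqP sp.
  transitivity ((2^-1 * q * (laplacian a p + laplacian b p)) * (a p - b p)).
    by rewrite -sp !exprMn exprVn; ring.
  by rewrite /X; move: (laplacian a p) (laplacian b p) => la lb; ring.
rewrite (Gsq a) (Gsq b) /q.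
move: (iint Om (grad_sq a)) (iint Om (grad_sq b)) (iint Om (grad_sq c)) => Ia Ib Ic.
move: (iint Om (fun p => ((a p - c p) / tau) ^+ 2)) => Ka.
move: (iint Om (fun p => ((c p - b p) / tau) ^+ 2)) => Kc /eqP.
by rewrite subr_eq => /eqP ->; field.
Qed.

Theorem mainTheorem1 (R : realType) (Om : set (R * R))
    (hOm : bounded_convex_domain Om)
    (alpha beta : R) (halpha : 0 < alpha) (hbeta : 0 < beta)
    (n : nat) (hn : (1 < n)%N) (T : R) (hT : 0 < T)
    (tau : R) (htau : tau = T / n%:R)
    (u : nat -> R * R -> R)
    (hu : forall k, (k <= n)%N -> dom_L0 Om (u k))
    (hscheme : forall k, (1 <= k <= n.-1)%N -> forall p, Om p ->
       (u k.+1 p - 2 * u k p + u k.-1 p) / tau ^+ 2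
         - 2^-1 * qcoef Om alpha beta u k
             * (laplacian (u k.+1) p + laplacian (u k.-1) p) = 0) :
  forall k, (1 <= k <= n.-1)%N ->
    energy1 Om alpha beta tau u k.+1 = energy1 Om alpha beta tau u 1.
Proof.
elim=> [|k IHk] /andP[k0 kn]; first by rewrite ltnn in k0.
have kn' : (k.+2 <= n)%N by rewrite -ltn_predRL.
have step : energy1 Om alpha beta tau u k.+2 = energy1 Om alpha beta tau u k.+1.
  apply: (energy_step alpha beta tau u k.+1 hOm (hu k _) (hu k.+1 _) (hu k.+2 kn')).
  - exact: leq_trans (leqW (leqnSn k)) kn'.
  - exact: ltnW kn'.
  - by apply: (hscheme k.+1); rewrite kn.
rewrite step; case: k IHk kn {k0 kn' step} => [_ _ //|k IHk kn].
by apply: IHk; exact: ltnW.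
Qed.
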